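(* Let $\Delta$ be a dp-controllable finite set of conditional domain constraints (CDCs) and Y-UINDs over $R$. Then the Y-UINDs are $\{(\mathrm{dp})\}$-separable in $\Delta$ from the CDCs; that is, every horizontal decomposition of $R$ is lossless under $\Delta$ if and only if it is lossless under $\mathrm{cdc}(\Delta^* )$, where $\Delta^*$ is the closure of $\Delta$ under the domain propagation rule $(\mathrm{dp})$.
   Context: Setting. $\mathbf{dom}$ is a (possibly infinite) set of values; $\mathbf{idom}$ is a set of values from a specific interpreted domain (e.g. $\mathbb Z$) on which predicates and functions are defined according to a first-order language $\mathfrak C$ closed under negation. $R$ is a relation symbol of arity $n$ whose first $k$ positions are non-interpreted (values from $\mathbf{dom}$) and whose remaining $n-k$ positions are interpreted (values from $\mathbf{idom}$). Variables $\overline x=(x_1,\dots,x_k)$ refer to non-interpreted positions, $\overline y=(y_1,\dots,y_{n-k})$ to interpreted ones ($y_i$ refers to position $k+i$). $\mathfrak C$-formulae have free variables among $\overline y$. All instances (associating relation symbols with subsets of $\mathbf{dom}^k\times\mathbf{idom}^{n-k}$) are finite; entailment $\models$ is with respect to finite instances. A CDC is a formula $\forall\overline x,\overline y.\,(R(\overline x,\overline y)\land\lambda(\overline x))\to\delta(\overline y)$, written $\lambda(\overline x)\to\delta(\overline y)$, where $\lambda$ is a Boolean combination of equalities $x_i=a$ with $a\in\mathbf{dom}$ (possibly $\top$) and $\delta(\overline y)\in\mathfrak C$. $\mathrm{cdc}(\Gamma)$ is the set of all CDCs in $\Gamma$. A Y-UIND $R[y_i]\subseteq R[y_j]$ is a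 unary inclusion dependency between interpreted positions: it is satisfied by $I$ if every value in column $i+k$ of $R^I$ appears in column $j+k$ of $R^I$. A horizontal decomposition $\Sigma$ is a finite set of view definitions, one for each view symbol $V_1,\dots,V_m$ (each of the same arity and position types as $R$), of the form $\forall\overline x,\overline y.\,V_i(\overline x,\overline y)\leftrightarrow(R(\overline x,\overline y)\land\lambda_i(\overline x)\land\sigma_i(\overline y))$, with $\lambda_i$ a Boolean combination of equalities as for CDCs (possibly $\top$) and $\sigma_i\in\mathfrak C$; the conjunct $\sigma_i$ may be absent. $\Sigma$ is lossless under a set $\Gamma$ of constraints over $R$ if $\Gamma\cup\Sigma\models\forall\overline x,\overline y.\,R(\overline x,\overline y)\leftrightarrow\bigvee_iV_i(\overline x,\overline y)$. Domain propagation rule $(\mathrm{dp})$: from a CDC $\top\to\delta(y_i)$ (where $y_i$ is the only free variable of $\delta$) and a Y-UIND $R[y_j]\subseteq R[y_i]$, derive the CDC $\top\to\delta(y_j)$, where the $\mathfrak C$-formula $\delta(y_j)$ is obtained by replacing $y_i$ with $y_j$. dp-controllable: a set $\Delta$ of CDCs and Y-UINDs is dp-controllable if, for every Y-UIND $R[y_i]\subseteq R[y_j]$ in $\Delta$ with $i\ne j$, all CDCs in $\Delta$ mentioning the variable $y$, where $y$ is $y_i$ or $y_j$, are of the form $\top\to\delta(y)$ (with $y$ the only free variable of $\delta$). Separability: for a finite set $\mathcal S$ of sound inference rules, the constraints in $\Delta$ other than CDCs are $\mathcal S$-separable in $\Delta$ from the CDCs if every horizontal decomposition is lossless under $\Delta$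 exactly when it is lossless under $\mathrm{cdc}(\Delta^* )$, with $\Delta^*$ the closure of $\Delta$ under $\mathcal S$. *)

(* Defs.v *)
From mathcomp Require Import all_boot.
From mathcomp Require Import boolp classical_sets functions cardinality.
From Stdlib Require List.

Set Implicit Arguments.
Unset Strict Implicit.
Unset Printing Implicit Defensive.

Local Open Scope classical_set_scope.

Record fo_structure (idom : Type) := FoStructure {
  fsym : Type;
  farity : fsym -> nat;
  fint : forall f : fsym, ('I_(farity f) -> idom) -> idom;
  psym : Type;
  parity : psym -> nat;
  pint : forall p : psym, ('I_(parity p) -> idom) -> Prop }.

(* Well-scoped de Bruijn syntax: [formula L m] has its free variables among
   y_0, ..., y_(m-1).  Under a quantifier the bound variable is [ord0] and the
   outer variable i becomes [lift ord0 i]; a bound variable is therefore never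
   one of the y_i, and variable replacement is capture-free. *)
Inductive term (idom : Type) (L : fo_structure idom) (m : nat) :=
  | TVar of 'I_m
  | TApp (f : fsym L) of ('I_(farity f) -> term L m).
Arguments TVar {idom L m} _.
Arguments TApp {idom L m} _ _.

Inductive formula (idom : Type) (L : fo_structure idom) : nat -> Type :=
  | FFalse m : formula L m
  | FEq m (t u : term L m) : formula L m
  | FPred m (p : psym L) (ts : 'I_(parity p) -> term L m) : formula L m
  | FNot m (phi : formula L m) : formula L m
  | FAnd m (phi psi : formula L m) : formula L m
  | FOr m (phi psi : formula L m) : formula L m
  | FImp m (phi psi : formula L m) : formula L m
  | FAll m (phi : formula L m.+1) : formula L m
  | FEx m (phi : formula L m.+1) : formula L m.
Arguments FFalse {idom L m}.

Section Semantics.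
Variables (idom : Type) (L : fo_structure idom).

Fixpoint teval m (t : term L m) (e : 'I_m -> idom) : idom :=
  match t with
  | TVar i => e i
  | TApp f ts => fint (fun a => teval (ts a) e)
  end.

Definition env_cons m (v : idom) (e : 'I_m -> idom) (i : 'I_m.+1) : idom :=
  if unlift ord0 i is Some j then e j else v.

Fixpoint feval m (phi : formula L m) : ('I_m -> idom) -> Prop :=
  match phi in formula _ m return ('I_m -> idom) -> Prop with
  | FFalse _ => fun _ => False
  | FEq _ t u => fun e => teval t e = teval u e
  | FPred _ p ts => fun e => pint (fun a => teval (ts a) e)
  | FNot _ phi => fun e => ~ feval phi e
  | FAnd _ phi psi => fun e => feval phi e /\ feval psi e
  | FOr _ phi psi => fun e => feval phi e \/ feval psi e
  | FImp _ phi psi => fun e => feval phi e -> feval psi e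
  | FAll _ phi => fun e => forall v, feval phi (env_cons v e)
  | FEx _ phi => fun e => exists v, feval phi (env_cons v e)
  end.

Fixpoint tfree m (i : 'I_m) (t : term L m) : bool :=
  match t with
  | TVar j => i == j
  | TApp f ts => [exists a, tfree i (ts a)]
  end.

Fixpoint free m (phi : formula L m) : 'I_m -> bool :=
  match phi in formula _ m return 'I_m -> bool with
  | FFalse _ => fun _ => false
  | FEq _ t u => fun i => tfree i t || tfree i u
  | FPred _ p ts => fun i => [exists a, tfree i (ts a)]
  | FNot _ phi => fun i => free phi i
  | FAnd _ phi psi | FOr _ phi psi | FImp _ phi psi =>
      fun i => free phi i || free psi i
  | FAll _ phi | FEx _ phi => fun i => free phi (lift ord0 i)
  end.

Definition only_free m (phi : formula L m) (i : 'I_m) : Prop :=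
  forall l, free phi l = (l == i).

Fixpoint trename m m' (r : 'I_m -> 'I_m') (t : term L m) : term L m' :=
  match t with
  | TVar i => TVar (r i)
  | TApp f ts => TApp f (fun a => trename r (ts a))
  end.

Definition rlift m m' (r : 'I_m -> 'I_m') (i : 'I_m.+1) : 'I_m'.+1 :=
  if unlift ord0 i is Some j then lift ord0 (r j) else ord0.

Fixpoint frename m (phi : formula L m) :
    forall m', ('I_m -> 'I_m') -> formula L m' :=
  match phi in formula _ m
    return forall m', ('I_m -> 'I_m') -> formula L m' with
  | FFalse _ => fun m' r => FFalse
  | FEq _ t u => fun m' r => FEq (trename r t) (trename r u)
  | FPred _ p ts => fun m' r => FPred (fun a => trename r (ts a))
  | FNot _ phi => fun m' r => FNot (frename phi r)
  | FAnd _ phi psi => fun m' r => FAnd (frename phi r) (frename psi r)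
  | FOr _ phi psi => fun m' r => FOr (frename phi r) (frename psi r)
  | FImp _ phi psi => fun m' r => FImp (frename phi r) (frename psi r)
  | FAll _ phi => fun m' r => FAll (frename phi (rlift r))
  | FEx _ phi => fun m' r => FEx (frename phi (rlift r))
  end.

Definition replace_var m (i j : 'I_m) (phi : formula L m) : formula L m :=
  frename phi (fun l => if l == i then j else l).

Lemma teval_rename m m' (r : 'I_m -> 'I_m') (t : term L m) e e' :
  (forall i, tfree i t -> e' (r i) = e i) ->
  teval (trename r t) e' = teval t e.
Proof.
elim: t => [i|f ts IH] /= H; first exact: H.
congr (fint _); apply/funext => a; apply: IH => i Hi.
by apply: H; apply/existsP; exists a.
Qed.

Lemma feval_rename m (phi : formula L m) m' (r : 'I_m -> 'I_m') e e' :
  (forall i, free phi i -> e' (r i) = e i) ->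
  feval (frename phi r) e' <-> feval phi e.
Proof.
have lift_env n n' (psi : formula L n.+1) (s : 'I_n -> 'I_n') d d' v :
    (forall i, free psi (lift ord0 i) -> d' (s i) = d i) ->
    forall i, free psi i -> env_cons v d' (rlift s i) = env_cons v d i.
  move=> H i; rewrite /env_cons /rlift.
  case: (unliftP ord0 i) => [j ->|->]; last by rewrite unlift_none.
  by rewrite liftK; exact: H.
elim: phi m' r e e' => {m}
  [m|m t u|m p ts|m phi IH|m phi IH1 psi IH2|m phi IH1 psi IH2
  |m phi IH1 psi IH2|m phi IH|m phi IH] m' r e e' /= H.
- by [].
- by rewrite (teval_rename (e := e)) ?(teval_rename (e := e)) // => i Hi;
    apply: H; rewrite Hi ?orbT.
- suff -> : (fun a => teval (trename r (ts a)) e') =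
            (fun a => teval (ts a) e) by [].
  apply/funext => a; apply: teval_rename => i Hi.
  by apply: H; apply/existsP; exists a.
- by rewrite (IH _ _ e).
- by rewrite (IH1 _ _ e) ?(IH2 _ _ e) // => i Hi; apply: H; rewrite Hi ?orbT.
- by rewrite (IH1 _ _ e) ?(IH2 _ _ e) // => i Hi; apply: H; rewrite Hi ?orbT.
- by rewrite (IH1 _ _ e) ?(IH2 _ _ e) // => i Hi; apply: H; rewrite Hi ?orbT.
- by split=> Hv v; move: (Hv v); rewrite (IH _ _ (env_cons v e)) //;
    exact: lift_env.
- by split=> -[v Hv]; exists v; move: Hv; rewrite (IH _ _ (env_cons v e)) //;
    exact: lift_env.
Qed.

End Semantics.

(* A constraint language: a fragment of the first-order formulas in the
   variables y, closed under negation up to equivalence over the fixed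
   interpretation (the negation of an atom may be another atom). *)
Record language (idom : Type) (L : fo_structure idom) (m : nat) := Language {
  in_language :> formula L m -> Prop;
  language_neg : forall phi, in_language phi ->
    exists2 psi, in_language psi & forall e, feval psi e <-> ~ feval phi e }.

(* Non-interpreted components first, interpreted components second. *)
Definition fact (dom idom : Type) (k m : nat) : Type :=
  (k.-tuple dom * m.-tuple idom)%type.

Inductive eqcomb (dom : Type) (k : nat) :=
  | EqTop
  | EqVar (i : 'I_k) (a : dom)
  | EqNot (l : eqcomb dom k)
  | EqAnd (l1 l2 : eqcomb dom k)
  | EqOr (l1 l2 : eqcomb dom k).
Arguments EqTop {dom k}.

Fixpoint eqcomb_holds dom k (l : eqcomb dom k) (x : k.-tuple dom) : Prop :=
  match l with
  | EqTop => True
  | EqVar i a => tnth x i = a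
  | EqNot l => ~ eqcomb_holds l x
  | EqAnd l1 l2 => eqcomb_holds l1 x /\ eqcomb_holds l2 x
  | EqOr l1 l2 => eqcomb_holds l1 x \/ eqcomb_holds l2 x
  end.

(* [YUIND i j] is the inclusion R[y_i] <= R[y_j]. *)
Inductive constraint (dom idom : Type) (L : fo_structure idom) (k m : nat) :=
  | CDC (lambda : eqcomb dom k) (delta : formula L m)
  | YUIND (i j : 'I_m).
Arguments CDC {dom idom L k m} _ _.
Arguments YUIND {dom idom L k m} _ _.

Section Constraints.
Variables (dom idom : Type) (L : fo_structure idom) (k m : nat).
Implicit Types (c : constraint dom L k m) (R : set (fact dom idom k m)).

Definition satisfies R c : Prop :=
  match c with
  | CDC lambda delta => forall x y, R (x, y) /\ eqcomb_holds lambda x ->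
                                    feval delta (tnth y)
  | YUIND i j => forall t, R t -> exists2 t', R t' & tnth t'.2 j = tnth t.2 i
  end.

Definition constraint_over (C : language L m) c : Prop :=
  if c is CDC _ delta then C delta else True.

Definition is_cdc c : Prop := if c is CDC _ _ then True else False.

Definition cdc (Gamma : set (constraint dom L k m)) :
    set (constraint dom L k m) :=
  [set c | Gamma c /\ is_cdc c].

Definition dp_controllable (Delta : set (constraint dom L k m)) : Prop :=
  forall i j, Delta (YUIND i j) -> i != j ->
  forall lambda delta, Delta (CDC lambda delta) ->
  forall y, y = i \/ y = j -> free delta y ->
  lambda = EqTop /\ only_free delta y.

(* A rule carries its soundness over finite instances, so that a [seq rule] is a
   finite set of sound rules. *)
Record rule := Rule {
  derives :> set (constraint dom L k m) -> constraint dom L k m -> Prop;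
  rule_sound : forall P c, derives P c ->
    forall R, finite_set R -> (forall p, P p -> satisfies R p) ->
    satisfies R c }.

Inductive closure (S : seq rule) (Delta : set (constraint dom L k m)) :
    constraint dom L k m -> Prop :=
  | closure_base c : Delta c -> closure S Delta c
  | closure_step (r : rule) (P : set (constraint dom L k m)) c :
      List.In r S -> (forall p, P p -> closure S Delta p) -> r P c ->
      closure S Delta c.

(* A constraint language is not assumed to be closed under [replace_var]; when it
   is, every CDC derived by this rule is again over that language. *)
Inductive dp_derives :
    set (constraint dom L k m) -> constraint dom L k m -> Prop :=
  | DpDerives (i j : 'I_m) (delta : formula L m) :
      only_free delta i ->
      dp_derives [set CDC EqTop delta; YUIND j i]
                 (CDC EqTop (replace_var i j delta)).

Lemma dp_sound P c : dp_derives P c ->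
  forall R, finite_set R -> (forall p, P p -> satisfies R p) ->
  satisfies R c.
Proof.
case=> i j delta fi R _ sat x y [Rxy _].
have /= satD := sat (CDC EqTop delta) (or_introl erefl).
have /= satU := sat (YUIND j i) (or_intror erefl).
have [[x' y'] Rt' /= eqy] := satU _ Rxy.
apply/(feval_rename (e := tnth y')); last exact: (satD x' y').
by move=> l; rewrite fi => /eqP ->; rewrite eqxx eqy.
Qed.

Definition dp : rule := Rule dp_sound.

(* The conjunct sigma may be absent. *)
Record view_def := ViewDef {
  vlambda : eqcomb dom k;
  vsigma : option (formula L m) }.

Definition decomposition (s : nat) : Type := s.-tuple view_def.

Definition view_def_over (C : language L m) (v : view_def) : Prop :=
  if vsigma v is Some sigma then C sigma else True.

Record instance (s : nat) := Instance {
  base : set (fact dom idom k m);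
  view : 'I_s -> set (fact dom idom k m);
  base_finite : finite_set base;
  view_finite : forall i, finite_set (view i) }.

Definition satisfies_view s (I : instance s) (i : 'I_s) (v : view_def) : Prop :=
  forall x y, view I i (x, y) <->
    [/\ base I (x, y), eqcomb_holds (vlambda v) x &
        if vsigma v is Some sigma then feval sigma (tnth y) else True].

Definition lossless s (Sigma : decomposition s)
    (Gamma : set (constraint dom L k m)) : Prop :=
  forall I : instance s,
    (forall c, Gamma c -> satisfies (base I) c) ->
    (forall i, satisfies_view I i (tnth Sigma i)) ->
    forall x y, base I (x, y) <-> exists i, view I i (x, y).

Definition separable (C : language L m) (S : seq rule)
    (Delta : set (constraint dom L k m)) : Prop :=
  forall s (Sigma : decomposition s),
    (forall i, view_def_over C (tnth Sigma i)) ->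
    (lossless Sigma Delta <-> lossless Sigma (cdc (closure S Delta))).

End Constraints.
Arguments dp {dom idom L k m}.

(* Main.v *)
(** A CDC constrains each tuple separately, so a failure of losslessness under
    [cdc (Delta^* )] is witnessed by one tuple [t = (x, y)] satisfying all CDCs
    of the closure.  Let [J] consist of the tuples [(x, y')] in which every
    [y'_l] is some [y_i] with [i] reaching [l] along the Y-UINDs of [Delta].
    Then [J] is finite, contains [t] and satisfies the Y-UINDs.  It satisfies
    the CDCs too: where [y'_l] differs from [y_l], dp-controllability leaves
    only conditions [delta(y_l)], and [delta(y_i)] holds at [t] because it is
    obtained from [delta(y_l)] by (dp).  So [t], which is in no view, also
    refutes losslessness under [Delta]. *)
Require Import Defs.
From mathcomp Require Import all_boot.
From mathcomp Require Import boolp classical_sets functions cardinality.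

Local Open Scope classical_set_scope.

Section Formulas.
Set Implicit Arguments.
Unset Strict Implicit.
Context {idom : Type} {L : fo_structure idom}.

Lemma exists_and_exchange {S T : finType} (P : S -> pred T) (Q : pred T) :
  [exists a, [exists i, P a i && Q i]] = [exists i, [exists a, P a i] && Q i].
Proof.
apply/existsP/existsP => [[a /existsP[i /andP[Pai Qi]]]|].
  by exists i; rewrite Qi andbT; apply/existsP; exists a.
move=> [i /andP[/existsP[a Pai] Qi]].
by exists a; apply/existsP; exists i; rewrite Pai.
Qed.

Lemma tfree_rename {m m'} (r : 'I_m -> 'I_m') (t : term L m) l :
  tfree l (trename r t) = [exists i, tfree i t && (r i == l)].
Proof.
elim: t => [i|f ts IH] /=.
  apply/eqP/existsP => [->|[j /andP[/eqP -> /eqP //]]].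
  by exists i; rewrite !eqxx.
by rewrite -exists_and_exchange; apply: eq_existsb => a.
Qed.

Lemma existsU_andl {T : finType} (P Q R : pred T) :
  [exists i, (P i || Q i) && R i] =
  [exists i, P i && R i] || [exists i, Q i && R i].
Proof.
apply/existsP/orP => [[i /andP[/orP[h|h] Ri]]|[] /existsP[i /andP[h Ri]]].
- by left; apply/existsP; exists i; rewrite h.
- by right; apply/existsP; exists i; rewrite h.
- by exists i; rewrite h Ri.
- by exists i; rewrite h Ri orbT.
Qed.

Lemma free_rename {m} (phi : formula L m) {m'} (r : 'I_m -> 'I_m') l :
  free (frename phi r) l = [exists i, free phi i && (r i == l)].
Proof.
(* Under a quantifier only lifted variables count: [rlift s] fixes [ord0], which is never a
   [lift]. *)
have lift_ex n n' (s : 'I_n -> 'I_n') (F : pred 'I_n.+1) (h : 'I_n') :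
    [exists i, F i && (rlift s i == lift ord0 h)] =
    [exists i, F (lift ord0 i) && (s i == h)].
  apply/existsP/existsP => -[i].
    rewrite /rlift; case: (unliftP ord0 i) => [j ->|_ /andP[_ /eqP //]].
    by rewrite (inj_eq lift_inj) => ?; exists j.
  by move=> Fi; exists (lift ord0 i); rewrite /rlift liftK (inj_eq lift_inj).
elim: phi m' r l => {m}
  [m|m t u|m p ts|m phi IH|m phi IH1 psi IH2|m phi IH1 psi IH2
  |m phi IH1 psi IH2|m phi IH|m phi IH] m' r l /=;
  rewrite ?tfree_rename ?IH1 ?IH2 ?IH ?existsU_andl ?lift_ex //.
  by apply/esym/existsP => -[].
rewrite -exists_and_exchange; apply: eq_existsb => a.
exact: tfree_rename.
Qed.

(** Makes (dp) applicable again to its own conclusion, hence along a whole path of Y-UINDs. *)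
Lemma only_free_replace {m} (i j : 'I_m) (phi : formula L m) :
  only_free phi i -> only_free (replace_var i j phi) j.
Proof.
move=> fi l; rewrite free_rename eq_sym.
apply/existsP/idP => [[h]|jl]; first by rewrite fi => /andP[->].
by exists i; rewrite fi eqxx.
Qed.

Lemma feval_eq_free {m} (phi : formula L m) e e' :
  (forall i, free phi i -> e i = e' i) -> feval phi e <-> feval phi e'.
Proof.
move=> ee'; apply: (iff_trans (B := feval (frename phi id) e')).
  by apply: iff_sym; apply: feval_rename => i /ee'.
exact: feval_rename.
Qed.

End Formulas.

Section Separability.
Set Implicit Arguments.
Unset Strict Implicit.
Context {dom idom : Type} {L : fo_structure idom} {k m : nat}.
Variable Delta : set (constraint dom L k m).
Implicit Types (R : set (fact dom idom k m)) (e : 'I_m -> idom).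

Lemma closure_sound (S : seq (rule dom L k m)) R :
  finite_set R -> (forall c, Delta c -> satisfies R c) ->
  forall c, Defs.closure S Delta c -> satisfies R c.
Proof.
move=> finR satR c; elim=> [{}c /satR //|r P {}c _ _ IH rPc].
exact: rule_sound rPc _ finR IH.
Qed.

(** Loops are left out: such inclusions hold trivially, and dp-controllability says nothing about
    them. *)
Definition uind_edge (i j : 'I_m) : bool :=
  (i != j) && `[< Delta (YUIND i j) >].

(** Induction on the path: (dp) carries the condition backwards over each edge, from the including
    column to the included one. *)
Lemma dp_connect i j (delta : formula L m) :
  connect uind_edge i j -> only_free delta j ->
  Defs.closure [:: dp] Delta (CDC EqTop delta) ->
  exists delta', [/\ only_free delta' i,
    Defs.closure [:: dp] Delta (CDC EqTop delta') &
    forall e e', e i = e' j -> feval delta' e <-> feval delta e'].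
Proof.
case/connectP => p; elim: p i => [|z p IH] i /=.
  move=> _ -> fi cl; exists delta; split=> // e e' ee'.
  by apply: feval_eq_free => l; rewrite fi => /eqP ->.
case/andP=> /andP[_ /asboolP iz] zp jE fj cl.
have [d [fz cld dE]] := IH z zp jE fj cl.
exists (replace_var z i d); split; first exact: only_free_replace.
  apply: (closure_step (r := dp) (P := [set CDC EqTop d; YUIND i z])).
  - by left.
  - by move=> c [->|->] //; exact: closure_base.
  - exact: DpDerives.
(* The constant environment is a bridge: [d] has only [z] free, so only the value [e i] matters. *)
move=> e e' ee'; apply: (iff_trans (B := feval d (fun=> e i))).
  by apply: feval_rename => l; rewrite fz => /eqP ->; rewrite eqxx.
exact: dE.
Qed.

(** For [uind_edge], this exhibits [j] as the target of a nontrivial Y-UIND, so that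
    dp-controllability applies to CDCs mentioning [y_j]. *)
Lemma connect_last_edge (T : finType) (e : rel T) i j :
  connect e i j -> i != j -> exists z, e z j.
Proof.
case/connectP => p; case/lastP: p => [_ ->|p z]; first by rewrite eqxx.
by rewrite rcons_path last_rcons => /andP[_ ez] -> _; exists (last i p).
Qed.

Definition chase_set (t : fact dom idom k m) : set (fact dom idom k m) :=
  [set t' | t'.1 = t.1 /\
    forall l, exists2 i, connect uind_edge i l & tnth t'.2 l = tnth t.2 i].

Lemma chase_set_self t : chase_set t t.
Proof. by split=> // l; exists l. Qed.

Lemma chase_set_finite t : finite_set (chase_set t).
Proof.
(* A tuple of the set is determined by choosing a source position in [t] for each position. *)
apply: (sub_finite_set (B :=
  (fun f : {ffun 'I_m -> 'I_m} => (t.1, [tuple tnth t.2 (f l) | l < m]))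
    @` setT)); last exact/finite_image/finite_finset.
move=> [x y] [/= -> yP].
have /choice[f fE] l : exists i, tnth y l = tnth t.2 i.
  by have [i] := yP l; exists i.
exists (finfun f) => //; congr (_, _); apply: eq_from_tnth => l.
by rewrite tnth_mktuple ffunE fE.
Qed.

Lemma chase_set_sat t : dp_controllable Delta ->
  (forall c, cdc (Defs.closure [:: dp] Delta) c -> satisfies [set t] c) ->
  forall c, Delta c -> satisfies (chase_set t) c.
Proof.
case: t => x y ctrl sat [lambda delta|i j] Dc /=.
  move=> x' y' [[/= -> yP] lx].
  have dy : feval delta (tnth y).
    by apply: (sat (CDC lambda delta)) (conj erefl lx); split;
      first exact: closure_base.
  (* If [y'] agrees with [y] on the free variables, [delta] carries over from [t]; otherwise some
     free [l] takes its value from a different position [i] reaching it. *)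
  have [same|] := pselect (forall l, free delta l -> tnth y' l = tnth y l).
    exact/(feval_eq_free same).
  move=> /existsNP[l /not_implyP[fl neq]].
  have [i il yl] := yP l.
  have i_l : i != l by apply: contra_notN neq => /eqP i_l; rewrite yl i_l.
  have [z /andP[zl /asboolP uzl]] := connect_last_edge il i_l.
  have [lT fdl] := ctrl _ _ uzl zl _ _ Dc l (or_intror erefl) fl.
  subst lambda.
  have [d [_ cld dE]] := dp_connect il fdl (closure_base _ Dc).
  apply/(dE (tnth y) (tnth y') (esym yl)).
  by apply: (sat (CDC EqTop d)) (conj erefl lx).
move=> [x' y'] [/= xE yP].
have [<-|ij] := eqVneq i j; first by exists (x', y').
(* The witness is [t] with position [j] overwritten: the source of [y'_i] reaches [i], hence [j],
   and every other position reaches itself. *)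
exists (x, [tuple if l == j then tnth y' i else tnth y l | l < m]); last first.
  by rewrite /= tnth_mktuple eqxx.
split=> // l; rewrite /= tnth_mktuple.
case: eqVneq => [->|_]; last by exists l.
have [h hi ->] := yP i; exists h => //.
by apply: connect_trans hi (connect1 _); rewrite /uind_edge ij; apply/asboolP.
Qed.

End Separability.

Theorem theorem7 (dom idom : Type) (L : fo_structure idom)
    (n k : nat) (le_kn : (k <= n)%N)
    (C : language L (n - k))
    (Delta : set (constraint dom L k (n - k)))
    (finDelta : finite_set Delta)
    (DeltaC : forall c, Delta c -> constraint_over C c)
    (ctrl : dp_controllable Delta) :
  separable C [:: dp] Delta.
Proof.
move=> s Sigma _; split=> [ll I satI viewI x y|ll I satI viewI]; last first.
  apply: ll viewI => c [clc _].
  exact: closure_sound (base_finite I) satI c clc.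
split=> [Ixy|[i /viewI[]//]].
pose t := (x, y).
have sat c : cdc (Defs.closure [:: dp] Delta) c -> satisfies [set t] c.
  move=> clc; have := satI _ clc; case: clc => _; case: c => //= lambda delta.
  by move=> _ h x' y' [[-> ->] lx]; apply: (h x y).
pose V i : set (fact dom idom k (n - k)) :=
  [set u | [/\ chase_set Delta t u, eqcomb_holds (vlambda (tnth Sigma i)) u.1 &
    if vsigma (tnth Sigma i) is Some sigma
    then feval sigma (tnth u.2) else True]].
have finV i : finite_set (V i).
  by apply: sub_finite_set (chase_set_finite Delta t) => u [].
pose J := Instance (chase_set_finite Delta t) finV.
(* Losslessness puts [t] in some view of [J]; the conditions [lx] and [sy] concern [t] alone, so [t]
   lies in the same view of [I]. *)
have [i [_ lx sy]] :=
  (ll J (chase_set_sat ctrl sat) (fun i x' y' => iff_refl _) x y).1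
    (chase_set_self Delta t).
by exists i; apply/viewI.
Qed.
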